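(* Let $\mathbb{F}$ be a field with involution $\overline{\,\cdot\,}$, let $m,n\ge 1$, let $x,y\in\mathbb{F}^m$ and $z,w\in\mathbb{F}^n$ be column vectors with all entries nonzero, let $a,b\in\mathbb{F}\setminus\{0\}$, and let $$M=\left[\begin{array}{cc|cc}0&x^T&a&0\\ y&0&0&0\\ \hline b&0&0&z^T\\ 0&0&w&0\end{array}\right]$$ (a square matrix of order $m+n+2$). Assume $x^Ty\neq 0$, $z^Tw=0$ and $\zeta:=x^Ty+ab\neq 0$, that $M^\dagger$ exists and that $M$ is dual core EP invertible (equivalently, the scalars $s=x^*x$, $u=y^*y$, $t=z^*z$, $v=w^*w$, $q=a\overline{a}+x^*x$, $\alpha=\zeta\overline{\zeta}+a\overline{a}\,z^*z$ are all nonzero). Then the $^*$CEPMP inverse of $M$ is $$M_{\mathrm{cEP},\dagger}=\left[\begin{array}{cc|cc}0&\overline{\zeta}(u\alpha)^{-1}(x^Ty)y^*&a\overline{\zeta}\alpha^{-1}&0\\ q^{-1}\overline{x}&0&0&0\\ \hline \overline{a}q^{-1}&0&0&0\\ 0&\overline{a}(u\alpha)^{-1}(x^Ty)\overline{z}y^*&a\overline{a}\alpha^{-1}\overline{z}&0\end{array}\right].$$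
   Context: For a matrix $A=[a_{ij}]$ over a field $\mathbb{F}$ with involution $\overline{\,\cdot\,}$ (a field automorphism with $\overline{\overline{c}}=c$), $\overline{A}=[\overline{a_{ij}}]$ and $A^*=\overline{A}^{\,T}$. All $4\times4$ block matrices have rows and columns partitioned with sizes $1,m,1,n$; each $0$ is a zero block of the appropriate size. Matrices $M$ of the displayed form are the matrices whose associated digraph is a double star digraph, in canonical form. The Moore–Penrose inverse $A^\dagger$ is the unique $X$ (if it exists) with $AXA=A$, $XAX=X$, $(AX)^*=AX$, $(XA)^*=XA$. A square matrix $A$ is dual core EP invertible if there is $X$ with $A^{k+1}X=A^k$ for some nonnegative integer $k$, $X^2A=X$, $(XA)^*=XA$; such $X$ is unique, called the dual core EP inverse and denoted $A_{\mathrm{cEP}}$. When $A^\dagger$ and $A_{\mathrm{cEP}}$ exist, the $^*$CEPMP ($^*$core EP–Moore–Penrose) inverse of $A$ is the unique $X$ with $XAX=X$, $AX=AA_{\mathrm{cEP}}AA^\dagger$, $XA=A_{\mathrm{cEP}}A$; explicitly $A_{\mathrm{cEP},\dagger}=A_{\mathrm{cEP}}AA^\dagger$. *)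

(* Defs.v *)
From HB Require Import structures.
From mathcomp Require Import all_boot all_order all_algebra.

Set Implicit Arguments.
Unset Strict Implicit.
Unset Printing Implicit Defensive.

Import GRing.Theory.
Local Open Scope ring_scope.

Section GeneralizedInverses.

(* [involutive_rmorphism F] is the library's type of ring endomorphisms [theta]
   with [involutive theta]; such a map is automatically a field automorphism. *)
Variables (F : fieldType) (theta : involutive_rmorphism F).

Definition conj_mx p r (A : 'M[F]_(p, r)) : 'M[F]_(p, r) := map_mx theta A.

Definition star p r (A : 'M[F]_(p, r)) : 'M[F]_(r, p) := (conj_mx A)^T.

Definition is_moore_penrose p r (A : 'M[F]_(p, r)) (X : 'M[F]_(r, p)) : Prop :=
  [/\ A *m X *m A = A,
      X *m A *m X = X,
      star (A *m X) = A *m X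
    & star (X *m A) = X *m A].

Definition is_dual_core_EP p (A X : 'M[F]_p) : Prop :=
  [/\ exists k : nat, (A ^+ k.+1) *m X = A ^+ k,
      X ^+ 2 *m A = X
    & star (X *m A) = X *m A].

Definition moore_penrose_invertible p r (A : 'M[F]_(p, r)) : Prop :=
  exists X, is_moore_penrose A X.

Definition dual_core_EP_invertible p (A : 'M[F]_p) : Prop :=
  exists X, is_dual_core_EP A X.

(* Both witnesses are unique when they exist, so the existential quantifiers
   only serve to name the Moore-Penrose and dual core EP inverses of [A]. *)
Definition is_star_CEPMP p (A X : 'M[F]_p) : Prop :=
  exists Amp Acep : 'M[F]_p,
    [/\ is_moore_penrose A Amp,
        is_dual_core_EP A Acep
      & [/\ X *m A *m X = X,
            A *m X = A *m Acep *m A *m Amp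
          & X *m A = Acep *m A]].

End GeneralizedInverses.

Definition double_star_mx (F : fieldType) (m n : nat)
    (x y : 'cV[F]_m) (z w : 'cV[F]_n) (a b : F) : 'M[F]_((1 + m) + (1 + n)) :=
  block_mx (block_mx 0 x^T y 0) (block_mx a%:M 0 0 0)
           (block_mx b%:M 0 0 0) (block_mx 0 z^T w 0).

(* Main.v *)
Require Import Defs.
From HB Require Import structures.
From mathcomp Require Import all_boot all_order all_algebra ring.

Set Implicit Arguments.
Unset Strict Implicit.
Unset Printing Implicit Defensive.

Import GRing.Theory.
Local Open Scope ring_scope.

(** The generalized inverses of [M] are governed by its row and column spaces and
    by the row space of its high powers, all of dimension at most 4.  Multiplying
    rows by [M] on the right, with [e1], [e2] the rows picking the two hubs,
      [e1 M = x^T + a e2],  [x^T M = (x^T y) e1],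
      [e2 M = b e1 + z^T],  [z^T M = (z^T w) e2 = 0].
    So the row space of [M] is spanned by [e1, x^T, e2, z^T], its column space
    by [e1, y, e2, w], and [M = U K V] where [U] and [V] list these vectors and
    [K] is an invertible matrix of order 4, namely the double star with one
    leaf on each side and unit weights on the leaves.  Iterating, the row space
    of [M ^+ k], [k >= 3], is spanned by the two rows of [R]:
      [r1 = zeta e1 + a z^T],   [r2 = x^T + a e2],
    which [M] permutes up to a scalar: [r1 M = zeta r2], [r2 M = r1].

    The two generalized inverses exist exactly when the relevant row and column
    spaces are nondegenerate for the form [p q^H], with [^H] the conjugate
    transpose, that is when Gram matrices are invertible: those of [V] and [U]
    for the Moore-Penrose inverse ([moore_penrose_factor],
    [moore_penrose_factor_unit]), that of [R] for the dual core EP inverse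
    ([dual_core_EP_core], [dual_core_EP_core_unit]).  All three are diagonal
    here, with diagonals [(1, s, 1, t)], [(1, u, 1, v)] and [(alpha, q)]; this
    gives the stated equivalence.

    Finally the *CEPMP inverse is [Mcep M M^+] ([star_CEPMP_eq]), in which
    [Mcep M] is the orthogonal projector [R^H (R R^H)^-1 R] on the span of
    [r1, r2].  Writing [R = J V], the factors [V] cancel against the explicit
    Moore-Penrose inverse and
      [Mcep M M^+ = V^H J^H (R R^H)^-1 (J K^-1) (U^H U)^-1 U^H],
    a product of explicit small matrices ([core_product]). *)

(** * Gram matrices over a field with involution *)

Section GeneralInverses.

Variables (F : fieldType) (theta : involutive_rmorphism F).

Local Notation star := (star theta).

Lemma star_mulmx p q r (A : 'M[F]_(p, q)) (B : 'M[F]_(q, r)) :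
  star (A *m B) = star B *m star A.
Proof. by rewrite /Defs.star /conj_mx map_mxM trmx_mul. Qed.

Lemma starK p r (A : 'M[F]_(p, r)) : star (star A) = A.
Proof. by apply/matrixP=> i j; rewrite !mxE rmorphK. Qed.

Lemma star_invmx p (A : 'M[F]_p) : star (invmx A) = invmx (star A).
Proof. by rewrite /Defs.star /conj_mx map_invmx trmx_inv. Qed.

Lemma star_gram p r (R : 'M[F]_(p, r)) : star (R *m star R) = R *m star R.
Proof. by rewrite star_mulmx starK. Qed.

(** If a Hermitian [E] fixes the independent rows of [R] and has all its rows in
    their span, then the form is nondegenerate on that span: from
    [R = R E = R E^H = R R^H W^H], the matrix [W^H R'] inverts [R R^H]. *)
Lemma gram_unit p r (R : 'M[F]_(p, r)) (R' : 'M[F]_(r, p)) (E : 'M[F]_r)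
    (W : 'M[F]_(r, p)) :
  R *m R' = 1%:M -> star E = E -> R *m E = R -> E = W *m R ->
  R *m star R \in unitmx.
Proof.
move=> RR' starE RE EW.
have: R *m star R *m (star W *m R') = 1%:M.
  by rewrite mulmxA -(mulmxA R) -star_mulmx -EW starE RE.
by case/mulmx1_unit.
Qed.

Lemma star_row_proj p r (R : 'M[F]_(p, r)) :
  star (star R *m invmx (R *m star R) *m R)
    = star R *m invmx (R *m star R) *m R.
Proof. by rewrite !star_mulmx star_invmx star_gram starK mulmxA. Qed.

(** * Moore-Penrose inverses *)

Lemma moore_penrose_unique p r (A : 'M[F]_(p, r)) (X Y : 'M[F]_(r, p)) :
  is_moore_penrose theta A X -> is_moore_penrose theta A Y -> X = Y.
Proof.
move=> [AXA XAX sAX sXA] [AYA YAY sAY sYA].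
have AXY : A *m X = A *m Y.
  by rewrite -{1}AYA -mulmxA -{1}sAY -{1}sAX -star_mulmx !mulmxA AXA sAY.
have XYA : X *m A = Y *m A.
  by rewrite -{1}AYA -mulmxA mulmxA -{1}sXA -{1}sYA -star_mulmx -mulmxA
             (mulmxA A) AXA sYA.
by rewrite -XAX -mulmxA AXY mulmxA XYA.
Qed.

Section Factorization.

Variables (p q r : nat) (U : 'M[F]_(p, q)) (U' : 'M[F]_(q, p)).
Variables (K K' : 'M[F]_q) (V : 'M[F]_(q, r)) (V' : 'M[F]_(r, q)).
Hypotheses (KK' : K *m K' = 1%:M) (U'U : U' *m U = 1%:M).
Hypothesis (VV' : V *m V' = 1%:M).

(** MacDuffee's formula for a full-rank factorization, with an invertible middle
    factor kept apart so that only the Gram matrices of [U] and [V] have to be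
    inverted. *)
Lemma moore_penrose_factor :
  V *m star V \in unitmx -> star U *m U \in unitmx ->
  is_moore_penrose theta (U *m K *m V)
    (star V *m invmx (V *m star V) *m K' *m invmx (star U *m U) *m star U).
Proof.
move=> uG uH; have K'K := mulmx1C KK'.
have AX : U *m K *m V *m
    (star V *m invmx (V *m star V) *m K' *m invmx (star U *m U) *m star U)
    = U *m invmx (star U *m U) *m star U.
  rewrite !mulmxA -(mulmxA _ V) -(mulmxA _ (V *m _)) mulmxV // mulmx1.
  by rewrite -(mulmxA U) KK' mulmx1.
have XA : star V *m invmx (V *m star V) *m K' *m invmx (star U *m U) *m star U
    *m (U *m K *m V) = star V *m invmx (V *m star V) *m V.
  rewrite !mulmxA -(mulmxA _ (star U)) -(mulmxA _ (invmx (star U *m U))).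
  by rewrite mulVmx // mulmx1 -(mulmxA _ K') K'K mulmx1.
split.
- by rewrite AX !mulmxA -(mulmxA _ (star U)) mulmxKV.
- rewrite XA !mulmxA -(mulmxA _ V) -(mulmxA _ (V *m _)).
  by rewrite mulmxV // mulmx1.
- by rewrite AX; have := star_row_proj (star U); rewrite starK.
- by rewrite XA star_row_proj.
Qed.

(** The converse applies [gram_unit] to the two orthogonal projectors [X A] and
    [A X], which fix the rows of [V] and the columns of [U] because [K] and the
    frames can be cancelled on either side of [A]. *)
Lemma moore_penrose_factor_unit X :
  is_moore_penrose theta (U *m K *m V) X ->
  V *m star V \in unitmx /\ star U *m U \in unitmx.
Proof.
move=> [AXA XAX sAX sXA]; split.
  apply: (gram_unit (E := X *m (U *m K *m V)) (W := X *m U *m K) VV' sXA);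
    last by rewrite !mulmxA.
  have defV : K' *m U' *m (U *m K *m V) = V.
    by rewrite !mulmxA -(mulmxA K') U'U mulmx1 (mulmx1C KK') mul1mx.
  by rewrite -{1}defV -(mulmxA (K' *m U')) (mulmxA (U *m K *m V)) AXA.
have := @gram_unit _ _ (star U) (star U') (U *m K *m V *m X)
  (star X *m star V *m star K).
rewrite starK; apply=> //.
- by rewrite -star_mulmx U'U /Defs.star /conj_mx map_mx1 trmx1.
- have defU : U *m K *m V *m (V' *m K') = U.
    by rewrite mulmxA -(mulmxA _ V) VV' mulmx1 -mulmxA KK' mulmx1.
  rewrite -{1}sAX -star_mulmx; congr (Defs.star _ _).
  by rewrite -{2}defU mulmxA AXA.
- by rewrite -sAX !star_mulmx !mulmxA.
Qed.

End Factorization.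

(** * Dual core EP inverses *)

Section DualCoreEP.

Variable p : nat.
Implicit Types A X Y : 'M[F]_p.

Lemma dual_core_EP_expand A X j :
  is_dual_core_EP theta A X -> X = X ^+ j.+1 *m A ^+ j.
Proof.
case=> _ XXA _; elim: j => [|j IHj]; first by rewrite expr1 expr0 mulmx1.
rewrite mulmxE in IHj XXA *.
by rewrite -(addn2 j) exprD [A ^+ _]exprS mulrA -(mulrA (X ^+ j)) XXA -exprSr.
Qed.

(** With [X = X^(k+1) A^k], the product [X A X] contains [A^(k+1) X = A^k]. *)
Lemma dual_core_EP_outer A X : is_dual_core_EP theta A X -> X *m A *m X = X.
Proof.
move=> dX; have [[k AkX] _ _] := dX.
rewrite {1}(dual_core_EP_expand k dX) -(mulmxA _ (A ^+ k)) -[_ *m A]exprSr.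
by rewrite -mulmxA AkX -dual_core_EP_expand.
Qed.

Lemma dual_core_EP_absorb A X Y :
  is_dual_core_EP theta A X -> is_dual_core_EP theta A Y ->
  X *m A *m Y = X.
Proof.
move=> dX [[k AkY] _ _].
rewrite {1}(dual_core_EP_expand k dX) -(mulmxA _ (A ^+ k)) -[_ *m A]exprSr.
by rewrite -mulmxA AkY -dual_core_EP_expand.
Qed.

(** By absorption [X A] and [Y A] are Hermitian projectors with the same row
    space, hence equal; then [X = X A Y = Y A Y = Y]. *)
Lemma dual_core_EP_unique A X Y :
  is_dual_core_EP theta A X -> is_dual_core_EP theta A Y -> X = Y.
Proof.
move=> dX dY; have [_ _ sX] := dX; have [_ _ sY] := dY.
have XYA : X *m A = Y *m A.
  rewrite -(dual_core_EP_absorb dX dY) -mulmxA -{1}sX -{1}sY -star_mulmx.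
  by rewrite mulmxA (dual_core_EP_absorb dY dX) sY.
by rewrite -(dual_core_EP_absorb dX dY) XYA (dual_core_EP_outer dY).
Qed.

(** The rows of [R] are a basis of the core row space of [A]: they span an
    [A]-invariant space on which [A] acts invertibly, through [Z], and which
    contains the rows of some power of [A]. *)
Section Core.

Variables (q : nat) (A : 'M[F]_p) (R : 'M[F]_(q, p)) (R' : 'M[F]_(p, q)).
Variables (Z Z' : 'M[F]_q) (Q : 'M[F]_(p, q)) (k : nat).
Hypotheses (RA : R *m A = Z *m R) (ZZ' : Z *m Z' = 1%:M).
Hypotheses (Ak : A ^+ k = Q *m R) (RR' : R *m R' = 1%:M).

(** Since [A] is invertible on the span of [R], these rows lie in the row space
    of every power of [A]. *)
Lemma core_rows_pow j : exists B : 'M[F]_q, R = B *m R *m A ^+ j.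
Proof.
elim: j => [|j [B IHj]]; first by exists 1%:M; rewrite expr0 mulmx1 mul1mx.
exists (B *m Z'); rewrite exprS -[A * _]/(A *m _) mulmxA.
rewrite -(mulmxA _ R A) RA mulmxA -(mulmxA B) (mulmx1C ZZ') mulmx1.
exact: IHj.
Qed.

(** The inverse is the orthogonal projection onto the core row space followed by
    the inverse of [A] there. *)
Lemma dual_core_EP_core :
  R *m star R \in unitmx ->
  is_dual_core_EP theta A (star R *m invmx (R *m star R) *m Z' *m R).
Proof.
move=> uG; set X := (X in is_dual_core_EP _ _ X).
have XA : X *m A = star R *m invmx (R *m star R) *m R.
  by rewrite /X -mulmxA RA mulmxA -(mulmxA _ Z') (mulmx1C ZZ') mulmx1.
split.
- exists k; rewrite exprSr Ak -[_ * A]/(_ *m A) -(mulmxA Q) RA.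
  rewrite /X !mulmxA -(mulmxA (Q *m Z)) mulmxK //.
  by rewrite -(mulmxA Q) ZZ' mulmx1.
- rewrite mulmxE expr2 -mulrA -!mulmxE XA /X !mulmxA.
  by rewrite -(mulmxA (star R *m invmx _ *m Z')) mulmxK.
- by rewrite XA star_row_proj.
Qed.

Lemma dual_core_EP_core_unit X :
  is_dual_core_EP theta A X -> R *m star R \in unitmx.
Proof.
move=> dX; have [[j AjX] _ sX] := dX.
apply: (gram_unit (E := X *m A) (W := X ^+ k.+1 *m A *m Q) RR' sX).
  have [B defR] := core_rows_pow j.+1.
  by rewrite {1}defR -mulmxA (mulmxA (A ^+ _)) AjX -[_ *m A]exprSr -defR.
rewrite {1}(dual_core_EP_expand k dX) -!mulmxA -Ak; congr (_ *m _).
by rewrite mulmxE -exprSr exprS.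
Qed.

End Core.

(** The three *CEPMP equations force [X = (X A) X = Acep (A X)], and [A X] is
    prescribed; idempotence of [Acep A] removes the repeated factor. *)
Lemma star_CEPMP_eq A Amp Acep X :
  is_moore_penrose theta A Amp -> is_dual_core_EP theta A Acep ->
  is_star_CEPMP theta A X <-> X = Acep *m A *m Amp.
Proof.
move=> mpA dA; have outer := dual_core_EP_outer dA; split.
  case=> B [C [mpB dC [XAX AX XA]]].
  rewrite (moore_penrose_unique mpB mpA) (dual_core_EP_unique dC dA) in AX XA.
  by rewrite -XAX XA -mulmxA AX !mulmxA outer.
have [AmA mAm _ _] := mpA.
have AcA : Acep *m A *m Acep *m A = Acep *m A by rewrite outer.
move=> ->; exists Amp, Acep; split=> //; split; last 1 first.
- by rewrite -!mulmxA (mulmxA A Amp) AmA.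
- by rewrite -!mulmxA (mulmxA A Amp (A *m _)) !(mulmxA _ A) AmA !mulmxA AcA.
- by rewrite !mulmxA.
Qed.

End DualCoreEP.
End GeneralInverses.

(** * Reduction of a double star to order four *)

Section DoubleStar.

Variable F : fieldType.

(** The columns [e1, y, e2, w]; transposed, the rows [e1, x^T, e2, z^T].  With
    [m = n = 1] it also serves as the diagonal matrix [diag(1, c, 1, d)]. *)
Definition star_frame m n (x : 'cV[F]_m) (z : 'cV[F]_n) :
    'M[F]_((1 + m) + (1 + n), (1 + 1) + (1 + 1)) :=
  block_mx (block_mx 1%:M 0 0 x) 0 0 (block_mx 1%:M 0 0 z).

Definition hub_mx (a b : F) : 'M[F]_((1 + 1) + (1 + 1)) :=
  let e : 'cV[F]_1 := 1%:M in double_star_mx e e e e a b.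

Definition hub_inv_mx (a b : F) : 'M[F]_((1 + 1) + (1 + 1)) :=
  block_mx (block_mx 0 1%:M 1%:M 0) (block_mx 0 0 0 (- a)%:M)
           (block_mx 0 0 0 (- b)%:M) (block_mx 0 1%:M 1%:M 0).

(** The coordinates of [r1 = zeta e1 + a z^T] and [r2 = x^T + a e2] in the frame
    [e1, x^T, e2, z^T]. *)
Definition core_mx (zeta a : F) : 'M[F]_(1 + 1, (1 + 1) + (1 + 1)) :=
  row_mx (block_mx zeta%:M 0 0 1%:M) (block_mx 0 a%:M a%:M 0).

Definition block_mxE := (tr_block_mx, tr_row_mx, mulmx_block, mul_row_block,
  mul_block_col, mul_row_col, mul_col_row, add_block_mx, add_row_mx,
  trmx0, trmx1, tr_scalar_mx).

Definition smulE := (mulmx0, mul0mx, mulmx1, mul1mx, addr0, add0r).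

Definition scalar_mxE := (mul_mx_scalar, mul_scalar_mx, scale_scalar_mx).

Lemma star_frame_dot m n (x y : 'cV[F]_m) (z w : 'cV[F]_n) :
  (star_frame x z)^T *m star_frame y w = star_frame (x^T *m y) (z^T *m w).
Proof. by rewrite /star_frame !block_mxE !smulE. Qed.

Lemma star_frame1 : star_frame 1%:M 1%:M = 1%:M.
Proof. by rewrite !scalar_mx_block. Qed.

Lemma double_star_factor m n (x y : 'cV[F]_m) (z w : 'cV[F]_n) a b :
  double_star_mx x y z w a b
    = star_frame y w *m hub_mx a b *m (star_frame x z)^T.
Proof.
rewrite /double_star_mx /hub_mx /star_frame /double_star_mx.
by rewrite !(block_mxE, smulE).
Qed.

(** In [M = e1^T (x^T + a e2) + y e1 + e2^T (b e1 + z^T) + w e2] the columns [y]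
    and [w] carry the rows [e1] and [e2]; recovering [x^T] and [z^T] from the
    remaining two terms needs the corrections [-a] and [-b]. *)
Lemma hub_mxK a b : hub_mx a b *m hub_inv_mx a b = 1%:M.
Proof.
rewrite /hub_mx /hub_inv_mx /double_star_mx !(block_mxE, smulE).
by rewrite -!raddfD /= addNr subrr raddf0 !block_mx0 -!scalar_mx_block.
Qed.

(** The rows [r1 M^+] and [r2 M^+] before normalization by [(U^H U)^-1]: as
    [zeta - a b = x^T y], they only involve the columns [y], [e2] and [e1]. *)
Lemma core_hub_inv xy a b :
  core_mx (xy + a * b) a *m hub_inv_mx a b
    = row_mx (block_mx 0 xy%:M 1%:M 0) (block_mx a%:M 0 0 0).
Proof.
rewrite /core_mx /hub_inv_mx !(block_mxE, smulE) !scalar_mxE -!raddfD /=.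
by rewrite mulNr (mulrC b) addrK addNr raddf0.
Qed.

(** The relations [r1 M = zeta r2] and [r2 M = r1]: in the frame
    [e1, x^T, e2, z^T], right multiplication by [M] is the matrix
    [diag(1, xy, 1, 0) * hub_mx a b]. *)
Lemma core_mx_hub xy a b :
  core_mx (xy + a * b) a *m (star_frame xy%:M 0 *m hub_mx a b)
    = block_mx 0 (xy + a * b)%:M 1%:M 0 *m core_mx (xy + a * b) a.
Proof.
rewrite /core_mx /hub_mx /star_frame /double_star_mx [RHS]mul_mx_row.
by rewrite !(block_mxE, smulE) !scalar_mxE -!raddfD /= (mulrC b).
Qed.

(** Applying [M] twice sends the whole row space of [M] into the span of
    [r1, r2]: [e1 -> r1], [x^T -> xy r2], [e2 -> b r2] and [z^T -> 0].  Hence the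
    rows of [M ^+ 3] lie in that span. *)
Lemma hub_square_core xy a b :
  exists Q : 'M_((1 + 1) + (1 + 1), 1 + 1),
    star_frame xy%:M 0 *m hub_mx a b *m (star_frame xy%:M 0 *m hub_mx a b)
    = Q *m core_mx (xy + a * b) a.
Proof.
exists (col_mx (block_mx 1%:M 0 0 xy%:M) (block_mx 0 b%:M 0 0)).
rewrite /core_mx /hub_mx /star_frame /double_star_mx.
by rewrite !(block_mxE, smulE) !scalar_mxE -?raddfD /= (mulrC b).
Qed.

Lemma core_mx_gram (theta : involutive_rmorphism F) zeta a s t :
  core_mx zeta a *m star_frame s%:M t%:M *m star theta (core_mx zeta a)
    = block_mx (zeta * theta zeta + a * theta a * t)%:M 0
               0 (a * theta a + s)%:M.
Proof.
rewrite /core_mx /star_frame /star /conj_mx.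
rewrite map_row_mx !map_block_mx !(map_scalar_mx, map_mx0).
rewrite !(block_mxE, smulE) !scalar_mxE -!raddfD /=.
rewrite rmorph1 mul1r (addrC s).
congr (block_mx (scalar_mx _) 0 0 (scalar_mx _)).
  by rewrite mulrC (mulrC t) mulrA (mulrC a).
by rewrite mulrC.
Qed.

Lemma core_mx_right_inv zeta a :
  zeta != 0 -> a != 0 -> exists J, core_mx zeta a *m J = 1%:M.
Proof.
move=> nz na.
(* The coordinates of [e1] in [r1] and of [e2] in [r2] are [zeta] and [a]; the
   other two vanish. *)
exists (col_mx (block_mx (zeta^-1)%:M 0 0 0) (block_mx 0 (a^-1)%:M 0 0)).
rewrite /core_mx !(block_mxE, smulE) !scalar_mxE !mulVf //.
by rewrite -scalar_mx_block.
Qed.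

Lemma diag2_unit (c d : F) :
  (block_mx c%:M 0 0 d%:M : 'M_(1 + 1)) \in unitmx = (c != 0) && (d != 0).
Proof. by rewrite unitmxE unitfE det_ublock !det_scalar1 mulf_eq0 negb_or. Qed.

Lemma star_frame_unit (c d : F) :
  star_frame c%:M d%:M \in unitmx = (c != 0) && (d != 0).
Proof.
rewrite unitmxE unitfE /star_frame !det_ublock !det_scalar1 !mul1r.
by rewrite mulf_eq0 negb_or.
Qed.

Lemma invmx_eq k (A B : 'M[F]_k) : A *m B = 1%:M -> invmx A = B.
Proof.
by move=> AB; case/mulmx1_unit: (AB) => uA _; rewrite -[LHS]mulmx1 -AB mulKmx.
Qed.

Lemma invmx_diag2 (c d : F) : c != 0 -> d != 0 ->
  invmx (block_mx c%:M 0 0 d%:M : 'M_(1 + 1))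
    = block_mx (c^-1)%:M 0 0 (d^-1)%:M.
Proof.
move=> nc nd; apply: invmx_eq.
by rewrite !(block_mxE, smulE) -!scalar_mxM !divff // -scalar_mx_block.
Qed.

Lemma invmx_star_frame (c d : F) : c != 0 -> d != 0 ->
  invmx (star_frame c%:M d%:M) = star_frame (c^-1)%:M (d^-1)%:M.
Proof.
move=> nc nd; apply: invmx_eq.
rewrite /star_frame !(block_mxE, smulE) -!scalar_mxM !divff //.
by rewrite -/(star_frame _ _) star_frame1.
Qed.

Lemma col_right_inv n (v : 'cV[F]_n) i :
  v i 0 != 0 -> exists v' : 'cV[F]_n, v^T *m v' = 1%:M.
Proof.
move=> nz; exists ((v i 0)^-1 *: delta_mx i 0).
rewrite -scalemxAr -colE; apply/matrixP=> j k.
by rewrite !mxE !ord1 mulVf.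
Qed.

(** * Conjugate transposes of the frames *)

Section Involution.

Variable theta : involutive_rmorphism F.

Lemma star_star_frame m n (y : 'cV[F]_m) (w : 'cV[F]_n) :
  star theta (star_frame y w)
    = (star_frame (conj_mx theta y) (conj_mx theta w))^T.
Proof.
rewrite /star_frame /star /conj_mx; congr trmx.
by rewrite !map_block_mx !(map_mx0, map_mx1).
Qed.

Lemma star_tr_star_frame m n (x : 'cV[F]_m) (z : 'cV[F]_n) :
  star theta (star_frame x z)^T
    = star_frame (conj_mx theta x) (conj_mx theta z).
Proof. by rewrite -[RHS]trmxK -star_star_frame /star /conj_mx -map_trmx. Qed.

Lemma star_core_mx zeta a :
  star theta (core_mx zeta a)
    = col_mx (block_mx (theta zeta)%:M 0 0 1%:M)
             (block_mx 0 (theta a)%:M (theta a)%:M 0).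
Proof.
rewrite /core_mx /star /conj_mx map_row_mx !map_block_mx.
by rewrite !(map_scalar_mx, map_mx0) rmorph1 !block_mxE.
Qed.

Lemma core_product m n (x y : 'cV[F]_m) (z w : 'cV[F]_n) xy zeta a alpha q u v :
  star theta (star_frame x z)^T *m star theta (core_mx zeta a)
    *m block_mx alpha^-1%:M 0 0 q^-1%:M
    *m row_mx (block_mx 0 xy%:M 1%:M 0) (block_mx a%:M 0 0 0)
    *m star_frame u^-1%:M v^-1%:M *m star theta (star_frame y w)
  = block_mx
      (block_mx 0 ((theta zeta * (u * alpha)^-1 * xy) *: star theta y)
                (q^-1 *: conj_mx theta x) 0)
      (block_mx (a * theta zeta * alpha^-1)%:M 0 0 0)
      (block_mx (theta a * q^-1)%:M 0
                0 ((theta a * (u * alpha)^-1 * xy) *: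
                     (conj_mx theta z *m star theta y)))
      (block_mx 0 0 ((a * theta a * alpha^-1) *: conj_mx theta z) 0).
Proof.
rewrite star_core_mx star_tr_star_frame star_star_frame /star_frame.
rewrite !(block_mxE, smulE) mul_col_mx !(block_mxE, smulE).
rewrite !scalar_mxE -?scalemxAl ?scalerA invfM.
congr (block_mx (block_mx 0 (_ *: _) (_ *: _) 0)
                (block_mx (scalar_mx _) 0 0 0)
                (block_mx (scalar_mx _) 0 0 (_ *: _))
                (block_mx 0 0 (_ *: _) 0)); ring.
Qed.

Lemma star_frame_gram m n (y : 'cV[F]_m) (w : 'cV[F]_n) :
  star theta (star_frame y w) *m star_frame y w
    = star_frame ((star theta y *m y) 0 0)%:M ((star theta w *m w) 0 0)%:M.
Proof. by rewrite star_star_frame star_frame_dot -!mx11_scalar. Qed.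

Lemma star_frame_tr_gram m n (x : 'cV[F]_m) (z : 'cV[F]_n) :
  (star_frame x z)^T *m star theta (star_frame x z)^T
    = star_frame ((star theta x *m x) 0 0)%:M ((star theta z *m z) 0 0)%:M.
Proof.
rewrite star_tr_star_frame.
have tr11 (A : 'M[F]_1) : A^T = A by rewrite [A]mx11_scalar tr_scalar_mx.
by rewrite star_frame_dot -!mx11_scalar -(tr11 (_ *m x)) -(tr11 (_ *m z))
  !trmx_mul !trmxK.
Qed.

End Involution.

End DoubleStar.

(** * The *CEPMP inverse of a double star *)

Theorem lemma5p4 (F : fieldType) (theta : involutive_rmorphism F)
    (m n : nat) (hm : (1 <= m)%N) (hn : (1 <= n)%N)
    (x y : 'cV[F]_m) (z w : 'cV[F]_n) (a b : F)
    (hx : forall i, x i 0 != 0) (hy : forall i, y i 0 != 0)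
    (hz : forall i, z i 0 != 0) (hw : forall i, w i 0 != 0)
    (ha : a != 0) (hb : b != 0) :
  let M := double_star_mx x y z w a b in
  let xy := (x^T *m y) 0 0 in
  let zeta := xy + a * b in
  let s := (star theta x *m x) 0 0 in
  let u := (star theta y *m y) 0 0 in
  let t := (star theta z *m z) 0 0 in
  let v := (star theta w *m w) 0 0 in
  let q := a * theta a + s in
  let alpha := zeta * theta zeta + a * theta a * t in
  xy != 0 -> (z^T *m w) 0 0 = 0 -> zeta != 0 ->
  (moore_penrose_invertible theta M /\ dual_core_EP_invertible theta M <->
   [/\ s != 0, u != 0, t != 0 & v != 0] /\ (q != 0 /\ alpha != 0)) /\
  (moore_penrose_invertible theta M -> dual_core_EP_invertible theta M ->
   forall X : 'M[F]_((1 + m) + (1 + n)),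
     is_star_CEPMP theta M X <->
     X = block_mx
           (block_mx 0 ((theta zeta * (u * alpha)^-1 * xy) *: star theta y)
                     (q^-1 *: conj_mx theta x) 0)
           (block_mx (a * theta zeta * alpha^-1)%:M 0
                     0 0)
           (block_mx (theta a * q^-1)%:M 0
                     0 ((theta a * (u * alpha)^-1 * xy) *:
                          (conj_mx theta z *m star theta y)))
           (block_mx 0 0
                     ((a * theta a * alpha^-1) *: conj_mx theta z) 0)).
Proof.
move=> M xy zeta s u t v q alpha nxy zw nzeta.
have [x' xx'] := col_right_inv (hx (Ordinal hm)).
have [y' yy'] := col_right_inv (hy (Ordinal hm)).
have [z' zz'] := col_right_inv (hz (Ordinal hn)).
have [w' ww'] := col_right_inv (hw (Ordinal hn)).
set U := star_frame y w; set V := (star_frame x z)^T.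
set K := hub_mx a b; set J := core_mx zeta a; set R := J *m V.
have defM : M = U *m K *m V by apply: double_star_factor.
have KK' : K *m hub_inv_mx a b = 1%:M by apply: hub_mxK.
have U'U : (star_frame y' w')^T *m U = 1%:M.
  rewrite -[LHS]trmxK trmx_mul trmxK star_frame_dot yy' ww'.
  by rewrite star_frame1 trmx1.
have VV' : V *m star_frame x' z' = 1%:M.
  by rewrite star_frame_dot xx' zz' star_frame1.
have VU : V *m U = star_frame xy%:M 0.
  by rewrite star_frame_dot (mx11_scalar (z^T *m w)) zw raddf0 -mx11_scalar.
have UU : star theta U *m U = star_frame u%:M v%:M by apply: star_frame_gram.
have VV : V *m star theta V = star_frame s%:M t%:M by apply: star_frame_tr_gram.
have [J' JJ'] := core_mx_right_inv nzeta ha.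
have RR' : R *m (star_frame x' z' *m J') = 1%:M.
  by rewrite /R mulmxA -(mulmxA J) VV' mulmx1.
have VM : V *m M = star_frame xy%:M 0 *m K *m V by rewrite defM !mulmxA VU.
pose Z : 'M[F]_(1 + 1) := block_mx 0 zeta%:M 1%:M 0.
pose Z' : 'M[F]_(1 + 1) := block_mx 0 1%:M (zeta^-1)%:M 0.
have RM : R *m M = Z *m R.
  by rewrite /R -mulmxA VM mulmxA core_mx_hub -mulmxA.
have ZZ' : Z *m Z' = 1%:M.
  by rewrite /Z /Z' !(block_mxE, smulE) -scalar_mxM divff // -scalar_mx_block.
have [Q0 defQ0] := hub_square_core xy a b.
have M3 : M ^+ 3 = U *m K *m Q0 *m R.
  rewrite !exprS expr0 mulr1 -!mulmxE {1}defM -!(mulmxA (U *m K)).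
  congr (_ *m _); rewrite (mulmxA V) VM -mulmxA VM !mulmxA.
  by rewrite -(mulmxA (_ *m K)) defQ0 -mulmxA.
have RR : R *m star theta R = block_mx alpha%:M 0 0 q%:M.
  by rewrite /R star_mulmx mulmxA -(mulmxA J) VV core_mx_gram.
have mpP : moore_penrose_invertible theta M
    <-> [/\ s != 0, u != 0, t != 0 & v != 0].
  split=> [[X]|[ns nu nt nv]]; rewrite ?defM.
    case/(moore_penrose_factor_unit KK' U'U VV'); rewrite UU VV.
    by rewrite !star_frame_unit => /andP[? ?] /andP[? ?].
  eexists; apply: moore_penrose_factor KK' _ _.
    by rewrite VV star_frame_unit ns nt.
  by rewrite UU star_frame_unit nu nv.
have epP : dual_core_EP_invertible theta M <-> q != 0 /\ alpha != 0.
  split=> [[X]|[nq nalpha]].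
    move/(dual_core_EP_core_unit RM ZZ' M3 RR'); rewrite RR diag2_unit.
    by case/andP.
  eexists; apply: (dual_core_EP_core RM ZZ' M3).
  by rewrite RR diag2_unit nalpha nq.
split; first by rewrite mpP epP.
move=> /mpP[ns nu nt nv] /epP[nq nalpha] X.
have uVV : V *m star theta V \in unitmx by rewrite VV star_frame_unit ns nt.
have uUU : star theta U *m U \in unitmx by rewrite UU star_frame_unit nu nv.
have uRR : R *m star theta R \in unitmx by rewrite RR diag2_unit nalpha nq.
have mpM := moore_penrose_factor KK' uVV uUU; rewrite -defM in mpM.
have epM := dual_core_EP_core RM ZZ' M3 uRR.
rewrite (star_CEPMP_eq X mpM epM).
set Y := (Y in X = Y <-> _); suff -> : Y =
    star theta V *m star theta J *m block_mx alpha^-1%:M 0 0 q^-1%:M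
    *m row_mx (block_mx 0 xy%:M 1%:M 0) (block_mx a%:M 0 0 0)
    *m star_frame u^-1%:M v^-1%:M *m star theta U.
  by rewrite core_product.
rewrite /Y -(mulmxA _ R) RM (mulmxA _ Z R) -(mulmxA _ Z') (mulmx1C ZZ') mulmx1.
rewrite RR UU invmx_diag2 // invmx_star_frame //.
rewrite -(core_hub_inv xy a b) -/zeta -/J [in LHS]/R star_mulmx !mulmxA.
by rewrite -(mulmxA _ V) -(mulmxA _ (V *m _)) mulmxV // mulmx1.
Qed.
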